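(* Let $\mathbf{p}=(p_i)_{i\ge1}$ with $p_1=0$, $p_2=1$, $p_i\in(0,1)$ for $i\ge3$, $q_i=1-p_i$, and let $\boldsymbol\theta=(\theta_i)_{i\ge1}$ be a sequence of strictly positive reals with $\theta_1=1$. Suppose that (i) $\theta_n=\dfrac{(n-1)q_n}{p_np_{n-1}}$ for $n\ge3$; (ii) as $n\to\infty$, $q_n\to0$ (or equivalently $\theta_n/n\to0$); (iii) $\displaystyle\sum_{i=3}^\infty\frac{q_iq_{i+1}}{(q_i+p_ip_{i-1})(q_{i+1}+p_{i+1}p_i)}=\sum_{i=3}^\infty\frac{\theta_i\theta_{i+1}}{(i-1+\theta_i)(i+\theta_{i+1})}<\infty$. Then $$\mathcal{L}(X^{\infty,\mathbf{p}})=\mathcal{L}(Y^{\boldsymbol\theta}\mid\tilde C_1(\infty)=0),\qquad\text{where }\tilde C_1(\infty)=\sum_{i=1}^\infty Y_iY_{i+1}.$$ Moreover, under assumptions (i), (ii) and (iii), the transition probabilities of $X^{\infty,\mathbf{p}}$ are, for $i\ge2$, $$\mathbb{P}_{\mathbf{p}}(X^\infty_{i+1}=1\mid X_i^\infty=0)=1-\mathbb{P}_{\mathbf{p}}(X^\infty_{i+1}=0\mid X_i^\infty=0)=\frac{\theta_{i+1}\gamma_{i+2,\infty}(\boldsymbol\theta)}{\theta_{i+1}\gamma_{i+2,\infty}(\boldsymbol\theta)+(i+\theta_{i+1})\gamma_{i+1,\infty}(\boldsymbol\theta)},$$ and $$\mathbb{P}_{\mathbf{p}}(X^\infty_{i+1}=1\mid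 X_i^\infty=1)=1-\mathbb{P}_{\mathbf{p}}(X^\infty_{i+1}=0\mid X_i^\infty=1)=0.$$
   Context: Random derangement process: for $n\ge 2$, $X^{n,\mathbf{p}}=(X^n_{n+1}=1,X^n_n,\dots,X^n_1)$ is the $\{0,1\}$-valued inhomogeneous Markov chain, run in decreasing index and started from $X^n_{n+1}=1$, such that $X^n_n=0$ a.s., $X^n_1=1$ a.s., and for $2\le r\le n-1$: $\mathbb{P}(X^n_r=0\mid X^n_{r+1}=0)=p_r$, $\mathbb{P}(X^n_r=1\mid X^n_{r+1}=0)=q_r$, $\mathbb{P}(X^n_r=0\mid X^n_{r+1}=1)=1$. When $\sum_jp_j=\infty$ (which holds if $q_n\to0$), the limits $\varphi_i=\lim_{n\to\infty}\mathbb{P}(X^n_i=1)$ exist, with $\varphi_1=1$, $\varphi_2=0$, $\varphi_i\in(0,1)$ for $i\ge3$, and $X^{\infty,\mathbf{p}}=(X_i^\infty)_{i\ge1}$ is defined as the $\{0,1\}$-valued Markov chain, run in increasing index, with $X_1^\infty=1$, $\mathbb{P}(X^\infty_{i+1}=1\mid X^\infty_i=0)=\frac{\varphi_{i+1}}{1-\varphi_i}$ and $\mathbb{P}(X^\infty_{i+1}=1\mid X^\infty_i=1)=0$. Generalized Feller coupling: $Y^{\boldsymbol\theta}=(Y_i)_{i\ge1}$ is a sequence of independent $\{0,1\}$-valued random variables with $\mathbb{P}_{\boldsymbol\theta}(Y_i=0)=\frac{i-1}{i-1+\theta_i}$ (so $Y_1=1$ a.s.). For $i\ge2$, $\gamma_{i,\infty}(\boldsymbol\theta)=\mathbb{P}_{\boldsymbol\theta}\bigl(Y_i+\sum_{j=i}^\infty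 Y_jY_{j+1}=0\bigr)$. $\mathcal{L}$ denotes law. *)

(* Defs.v *)
From HB Require Import structures.
From mathcomp Require Export all_boot all_order all_algebra finmap.
From mathcomp Require Export all_classical all_reals all_analysis.
Export Order.TTheory GRing.Theory Num.Theory.
Export numFieldNormedType.Exports.

Set Implicit Arguments.
Unset Strict Implicit.
Unset Printing Implicit Defensive.

Local Open Scope classical_set_scope.
Local Open Scope ring_scope.

(* Throughout, {0,1}-valued variables are bool-valued, and sequences indexed by
   i >= 1 are functions on nat whose value at 0 is irrelevant. *)

Section probabilities.
Context {d : measure_display} {T : measurableType d} {R : realType}.
Variable P : probability T R.

Definition Pr (A : set T) : R := fine (P A).

(* Elementary conditional probability; it is 0 when Pr B = 0, whence the guards
   below. *)
Definition cPr (A B : set T) : R := Pr (A `&` B) / Pr B.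

(* "P(V = b | U = a) = k"; as usual for the transitions of a Markov chain, this
   is no constraint when U = a is a null event. *)
Definition transition (U V : {RV P >-> bool}) (a b : bool) (k : R) : Prop :=
  Pr [set w | U w = a] != 0 ->
  cPr [set w | V w = b] [set w | U w = a] = k.

(* Markov property of Z_0, ..., Z_m. *)
Definition markov_upto (m : nat) (Z : nat -> {RV P >-> bool}) : Prop :=
  forall (k : nat) (s : nat -> bool), (k < m)%N ->
    let past := [set w | forall j, (j <= k)%N -> Z j w = s j] in
    Pr past != 0 ->
    cPr [set w | Z k.+1 w = s k.+1] past =
    cPr [set w | Z k.+1 w = s k.+1] [set w | Z k w = s k].

Definition mutually_independent (Y : nat -> {RV P >-> bool}) : Prop :=
  forall (J : {fset nat}) (B : nat -> set bool),
    (forall i, i \in J -> (1 <= i)%N) ->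
    Pr (\bigcap_(i in [set` J]) (Y i @^-1` B i)) =
    \prod_(i <- J) Pr (Y i @^-1` B i).

(* The path (X_1, X_2, ...), stored from position 0. *)
Definition path_of (X : nat -> {RV P >-> bool}) (w : T) : nat -> bool :=
  fun k => X k.+1 w.

Definition law (X : nat -> {RV P >-> bool}) (A : set (nat -> bool)) : R :=
  Pr (path_of X @^-1` A).

Definition cond_law (X : nat -> {RV P >-> bool}) (E : set T)
    (A : set (nat -> bool)) : R :=
  cPr (path_of X @^-1` A) E.

End probabilities.

Definition cylinders : set (set (nat -> bool)) :=
  [set A | exists (i : nat) (b : bool), A = [set x | x i = b]].

(* Equality of laws, i.e. on the product sigma-algebra of {0,1}^N. *)
Definition same_law {R : realType} (mu nu : set (nat -> bool) -> R) : Prop :=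
  forall A, <<s cylinders >> A -> mu A = nu A.

Section processes.
Context {R : realType}.

Definition q_ (p : nat -> R) (i : nat) : R := 1 - p i.

(* X n.+1, X n, ..., X 1, run in decreasing index. *)
Definition random_derangement_process (p : nat -> R) (n : nat)
    {d : measure_display} {T : measurableType d} (P : probability T R)
    (X : nat -> {RV P >-> bool}) : Prop :=
  [/\ Pr P [set w | X n.+1 w = true] = 1,
      Pr P [set w | X n w = false] = 1,
      Pr P [set w | X 1%N w = true] = 1,
      markov_upto n (fun k => X (n.+1 - k)%N) &
      forall r, (2 <= r <= n.-1)%N ->
        [/\ transition (X r.+1) (X r) false false (p r),
            transition (X r.+1) (X r) false true (q_ p r) &
            transition (X r.+1) (X r) true false 1]].

Definition phi {d : nat -> measure_display}
    {T : forall n, measurableType (d n)} (P : forall n, probability (T n) R)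
    (X : forall n, nat -> {RV (P n) >-> bool}) (i : nat) : R :=
  limn (fun n => Pr (P n) [set w | X n i w = true]).

Definition limit_chain (f : nat -> R)
    {d : measure_display} {T : measurableType d} (P : probability T R)
    (X : nat -> {RV P >-> bool}) : Prop :=
  [/\ Pr P [set w | X 1%N w = true] = 1,
      forall m, markov_upto m (fun k => X k.+1) &
      forall i, (1 <= i)%N ->
        transition (X i) (X i.+1) false true (f i.+1 / (1 - f i)) /\
        transition (X i) (X i.+1) true true 0].

Definition feller_coupling (theta : nat -> R)
    {d : measure_display} {T : measurableType d} (P : probability T R)
    (Y : nat -> {RV P >-> bool}) : Prop :=
  mutually_independent Y /\
  forall i, (1 <= i)%N ->
    Pr P [set w | Y i w = false] = (i%:R - 1) / (i%:R - 1 + theta i).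

Section coupling_counts.
Context {d : measure_display} {T : measurableType d} (P : probability T R).
Variable Y : nat -> {RV P >-> bool}.

(* \sum_(j >= i) Y_j Y_(j+1), possibly +oo. *)
Definition adjacent_ones (i : nat) (w : T) : \bar R :=
  (\sum_(i <= j <oo) ((Y j w)%:R * (Y j.+1 w)%:R)%:E)%E.

Definition C1_infty (w : T) : \bar R := adjacent_ones 1 w.

Definition gamma_infty (i : nat) : R :=
  Pr P [set w | ((Y i w)%:R%:E + adjacent_ones i w)%E = 0%E].

End coupling_counts.

End processes.

(* Main.v *)
(* A chain without adjacent ones is governed by its jump probabilities from 0
   to 1. For Y conditioned on having no adjacent ones, the jump probability into
   i is h_i = P(Y_i = 1 | no adjacent ones from i on); it is well defined
   because (iii) makes the event positive far out, by a union bound, and hence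
   everywhere. For X^infty it is phi_i / (1 - phi_(i-1)). Solving
   phi_i / (1 - phi_(i-1)) = h_i gives an explicit candidate in terms of gamma,
   and (i) turns the recursion gamma_i = P(Y_i = 0) (gamma_(i+1) +
   P(Y_(i+1) = 1) gamma_(i+2)) into phi_i = q_i (1 - phi_(i+1)). The numbers
   P(X^n_i = 1) satisfy the same recursion for i < n, which contracts because
   q_n -> 0; so they converge to the candidate whatever their value at i = n.
   In particular the existence of the limits phi_i needs no separate argument. *)
Require Import Defs.
From mathcomp Require Import ring lra zify.

Set Implicit Arguments.
Unset Strict Implicit.
Unset Printing Implicit Defensive.

Local Open Scope classical_set_scope.
Local Open Scope ring_scope.

(** * Real-valued elementary probability for boolean variables *)

Section elementary_probability.
Context {d : measure_display} {T : measurableType d} {R : realType}.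
Variable P : probability T R.
Implicit Types (A B : set T) (U : {RV P >-> bool}).

Lemma EFin_Pr A : measurable A -> (Pr P A)%:E = P A.
Proof. by move=> mA; rewrite /Pr fineK// fin_num_measure. Qed.

Lemma Pr_ge0 A : 0 <= Pr P A.
Proof. exact/fine_ge0/measure_ge0. Qed.

Lemma Pr_set0 : Pr P set0 = 0.
Proof. by rewrite /Pr measure0. Qed.

Lemma Pr_setT : Pr P setT = 1.
Proof. by rewrite /Pr probability_setT. Qed.

Lemma le_Pr A B : measurable A -> measurable B -> A `<=` B ->
  Pr P A <= Pr P B.
Proof.
move=> mA mB AB; rewrite -lee_fin !EFin_Pr//.
by apply: le_measure => //; rewrite inE.
Qed.

Lemma Pr_setU A B : measurable A -> measurable B -> A `&` B = set0 ->
  Pr P (A `|` B) = Pr P A + Pr P B.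
Proof.
move=> mA mB AB; apply: EFin_inj.
rewrite EFinD !EFin_Pr//; first exact: measureU.
exact: measurableU.
Qed.

Lemma measurable_RV_preimage U (B : set bool) : measurable (U @^-1` B).
Proof. by rewrite -[X in measurable X]setTI; exact: measurable_funP. Qed.

Lemma measurable_RV_eq U b : measurable [set w | U w = b].
Proof. exact: (measurable_RV_preimage U [set b]). Qed.

Lemma Pr_RV_split U A : measurable A ->
  Pr P A = Pr P (A `&` [set w | U w = true]) +
           Pr P (A `&` [set w | U w = false]).
Proof.
move=> mA; rewrite -Pr_setU.
- congr Pr; apply/seteqP; split=> w /=; last by case=> -[].
  by move=> Aw; case: (U w); [left|right].
- exact/measurableI/measurable_RV_eq.
- exact/measurableI/measurable_RV_eq.
- by rewrite -subset0 => w /= [[_ ->] []].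
Qed.

Lemma Pr_RV_true U : Pr P [set w | U w = true] = 1 - Pr P [set w | U w = false].
Proof.
rewrite -Pr_setT (Pr_RV_split U measurableT) !setTI; ring.
Qed.

Lemma cPr_RV_true U B : measurable B -> Pr P B != 0 ->
  cPr P [set w | U w = true] B = 1 - cPr P [set w | U w = false] B.
Proof.
move=> mB B0; rewrite /cPr -(divff B0) {2}(Pr_RV_split U mB).
by rewrite ![B `&` _]setIC -mulrBl addrK.
Qed.

(** Covers a null [B] as well: [cPr] is then 0 by convention, and the intersection is null by
    monotonicity. *)
Lemma Pr_setI_cPr A B : measurable A -> measurable B ->
  Pr P (A `&` B) = cPr P A B * Pr P B.
Proof.
move=> mA mB; rewrite /cPr; have [B0|B0] := eqVneq (Pr P B) 0.
  rewrite B0 mulr0; apply/eqP; rewrite eq_le Pr_ge0 andbT -B0.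
  by apply: le_Pr => //; exact: measurableI.
by rewrite divfK.
Qed.

End elementary_probability.

(** * The event without adjacent ones and its independence from earlier coordinates *)

Section no_adjacent_ones.
Context {d : measure_display} {T : measurableType d} {R : realType}.
Variable P : probability T R.
Variable Y : nat -> {RV P >-> bool}.

Definition no_adjacent_ones (i : nat) : set T :=
  [set w | forall j, (i <= j)%N -> ~~ (Y j w && Y j.+1 w)].

(** Here [n] counts pairs, so [n.+1] coordinates are inspected, from [i] to [i + n]. *)
Definition no_adjacent_ones_upto (i n : nat) : set T :=
  [set w | forall j, (i <= j < i + n)%N -> ~~ (Y j w && Y j.+1 w)].

Let adjacent_ones_term_ge0 w k :
  (0 <= ((Y k w)%:R * (Y k.+1 w)%:R : R)%:E)%E.
Proof. by rewrite lee_fin mulr_ge0. Qed.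

Lemma adjacent_ones_ge0 i w : (0 <= adjacent_ones Y i w)%E.
Proof. by apply: nneseries_ge0 => k _ _; exact: adjacent_ones_term_ge0. Qed.

Lemma adjacent_ones_eq0 i :
  [set w | adjacent_ones Y i w = 0%E] = no_adjacent_ones i.
Proof.
apply/seteqP; split=> w /= h; last first.
  rewrite /adjacent_ones eseries0// => k ik _.
  by have /nandP[/negbTE->|/negbTE->] := h k ik; rewrite ?mul0r ?mulr0.
(* If the term at [k] were 1, the partial sum up to [k] would be positive, yet it is bounded by the
   series, which is 0. *)
move=> k ik; apply/negP => /andP[Yk Yk1].
have : (\sum_(i <= j < k.+1) ((Y j w)%:R * (Y j.+1 w)%:R : R)%:E <= 0)%E.
  rewrite -[leRHS]h; apply: (@nneseries_lim_ge R _ xpredT i) => j _ _.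
  exact: adjacent_ones_term_ge0.
rewrite big_nat_recr//= Yk Yk1 mulr1 leNgt => /negP; apply.
rewrite -[ltLHS]adde0 lee_ltD//.
by rewrite sume_ge0// => j _; exact: adjacent_ones_term_ge0.
Qed.

Lemma measurable_no_adjacent_ones i : measurable (no_adjacent_ones i).
Proof.
have -> : no_adjacent_ones i = \bigcap_(j in [set j | (i <= j)%N])
   (~` ([set w | Y j w = true] `&` [set w | Y j.+1 w = true])).
  apply/seteqP; split=> w /= h j ij.
    by move=> /= [Yj Yj1]; move: (h j ij); rewrite Yj Yj1.
  by apply/negP => /andP[Yj Yj1]; exact: (h j ij).
apply: bigcap_measurable; first by exists i => /=.
by move=> j _; apply/measurableC/measurableI; exact: measurable_RV_eq.
Qed.

Lemma measurable_no_adjacent_ones_upto i n :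
  measurable (no_adjacent_ones_upto i n).
Proof.
elim: n => [|n IHn].
  rewrite [X in measurable X](_ : _ = setT)//.
  by apply/seteqP; split=> w //= _ j; lia.
rewrite [X in measurable X](_ : _ = no_adjacent_ones_upto i n `\`
   ([set w | Y (i + n) w = true] `&` [set w | Y (i + n).+1 w = true])).
  apply: measurableD => //; apply: measurableI; exact: measurable_RV_eq.
apply/seteqP; split=> w /=.
  move=> h; split=> [j ij|[Yj Yj1]]; first by apply: h; lia.
  by have := h (i + n)%N ltac:(lia); rewrite Yj Yj1.
move=> [h Yn] j ij; have [->|nj] := eqVneq j (i + n)%N.
  by apply/negP => /andP[]; move: Yn; tauto.
by apply: h; lia.
Qed.

(** Continuity from above: the finite-window events decrease to their intersection. Since
    [mutually_independent] speaks of finitely many coordinates only, independence is proved for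
    windows and carried over by this limit. *)
Lemma no_adjacent_ones_upto_cvg i (E : set T) : measurable E ->
  Pr P (E `&` no_adjacent_ones_upto i n) @[n --> \oo] -->
  Pr P (E `&` no_adjacent_ones i).
Proof.
move=> mE; have mF n : measurable (E `&` no_adjacent_ones_upto i n).
  exact/measurableI/measurable_no_adjacent_ones_upto.
have mE' : measurable (E `&` no_adjacent_ones i).
  exact/measurableI/measurable_no_adjacent_ones.
have FE : \bigcap_n (E `&` no_adjacent_ones_upto i n) =
    E `&` no_adjacent_ones i.
  apply/seteqP; split=> w /=.
    move=> h; split=> [|j ij]; first by case: (h 0%N I).
    by have [_] := h (j - i).+1 I; apply; lia.
  by move=> [Ew h] n _; split=> // j /andP[ij _]; exact: h.
apply: fine_cvg; rewrite EFin_Pr// -FE.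
apply: nonincreasing_cvg_mu => //.
- by rewrite -ge0_fin_numE// fin_num_measure.
- by rewrite FE.
- move=> m n mn; apply/subsetPset => w [Ew h]; split=> // j jm.
  by apply: h; lia.
Qed.

(** Product events in the coordinates 1 to [k]. They stand in for the whole past: their
    probabilities factor by independence, and they are stable under fixing the next coordinate. *)
Definition box (k : nat) (E : set T) : Prop := exists B : nat -> set bool,
  E = [set w | forall j, (1 <= j <= k)%N -> B j (Y j w)].

Lemma boxT k : box k setT.
Proof. by exists (fun=> setT); apply/seteqP; split. Qed.

Lemma boxI k E b : box k E -> box k.+1 (E `&` [set w | Y k.+1 w = b]).
Proof.
move=> [B ->]; exists (fun j => if j == k.+1 then [set b] else B j).
apply/seteqP; split=> w /= => [[h Yk] j jk|h].
  by case: eqVneq => [->//|nj]; apply: h; lia.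
split=> [j jk|]; last by have := h k.+1 (leqnn _); rewrite eqxx.
have := h j ltac:(lia); rewrite ifN//; lia.
Qed.

Lemma measurable_box k E : box k E -> measurable E.
Proof.
move=> [B ->]; rewrite [X in measurable X](_ : _ =
   \bigcap_(j in [set j | (1 <= j <= k)%N]) (Y j @^-1` B j)).
  apply: fin_bigcap_measurable; last by move=> *; exact: measurable_RV_preimage.
  apply: (@sub_finite_set _ _ `I_k.+1) (finite_II _) => j /=; lia.
by apply/seteqP; split=> w h j /= jk; exact: h.
Qed.

Hypothesis Yind : mutually_independent Y.

Lemma Pr_boxI k E b : box k E ->
  Pr P (E `&` [set w | Y k.+1 w = b]) = Pr P E * Pr P [set w | Y k.+1 w = b].
Proof.
have prod_box m (B : nat -> set bool) :
    Pr P [set w | forall j, (1 <= j <= m)%N -> B j (Y j w)] =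
    \prod_(1 <= j < m.+1) Pr P (Y j @^-1` B j).
  pose J : {fset nat} := [fset j in index_iota 1 m.+1]%fset.
  have -> : [set w | forall j, (1 <= j <= m)%N -> B j (Y j w)] =
      \bigcap_(j in [set` J]) (Y j @^-1` B j).
    apply/seteqP; split=> w h j; [move=> /= jJ|move=> jm].
      by apply: h; move: jJ; rewrite !inE mem_index_iota ltnS.
    by apply: h => /=; rewrite !inE mem_index_iota ltnS.
  rewrite Yind; last first.
    by move=> j; rewrite !inE mem_index_iota => /andP[].
  apply: perm_big; rewrite uniq_perm ?fset_uniq ?iota_uniq// => j.
  by rewrite !inE.
move=> [B ->].
pose B' j := if j == k.+1 then [set b] else B j.
rewrite prod_box [X in Pr P X](_ : _ =
    [set w | forall j, (1 <= j <= k.+1)%N -> B' j (Y j w)]).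
  rewrite prod_box big_nat_recr//= /B' eqxx; congr (_ * _).
  by apply: eq_big_nat => j jk; rewrite ifN//; lia.
apply/seteqP; split=> w /= => [[h Yk] j jk|h].
  by rewrite /B'; case: eqVneq => [->//|nj]; apply: h; lia.
split=> [j jk|]; last by have := h k.+1 (leqnn _); rewrite /B' eqxx.
have := h j ltac:(lia); rewrite /B' ifN//; lia.
Qed.

(** Split on [Y i]. If it is 1, then [Y i.+1] is 0, which settles the pairs at [i] and [i.+1] at
    once and leaves [n.-1] of the [n.+1] pairs. *)
Lemma no_adjacent_ones_uptoS i n :
  no_adjacent_ones_upto i n.+1 =
  ([set w | Y i w = false] `&` no_adjacent_ones_upto i.+1 n) `|`
  ([set w | Y i w = true] `&` [set w | Y i.+1 w = false] `&`
     no_adjacent_ones_upto i.+2 n.-1).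
Proof.
apply/seteqP; split=> w /=.
  move=> h; have := h i ltac:(lia); case Yi : (Y i w); case Yi1 : (Y i.+1 w) => // _.
  - by right; split=> // j jn; apply: h; lia.
  - by left; split=> // j jn; apply: h; lia.
  - by left; split=> // j jn; apply: h; lia.
move=> [[Yi h]|[[Yi Yi1] h]] j jn.
  have [->|ji] := eqVneq j i; first by rewrite Yi.
  by apply: h; lia.
have [->|ji] := eqVneq j i; first by rewrite Yi1 andbF.
have [->|ji1] := eqVneq j i.+1; first by rewrite Yi1.
apply: h; lia.
Qed.

(** Only the existence of a constant independent of [E] is claimed, which suits the induction;
    [E = setT] later identifies it as the probability of the window event. The induction is strong
    because the splitting drops one or two coordinates, and each piece is again a box followed by a
    shorter window. *)
Let indep_upto n k : exists c, forall E, box k E ->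
  Pr P (E `&` no_adjacent_ones_upto k.+1 n) = Pr P E * c.
Proof.
elim/ltn_ind: n k => -[_ k|n IHn k].
  exists 1 => E bE; rewrite mulr1; congr Pr.
  apply/seteqP; split=> w /=; first by case.
  by move=> Ew; split=> // j; lia.
have [c1 h1] := IHn n ltac:(lia) k.+1.
have [c2 h2] := IHn n.-1 ltac:(lia) k.+2.
exists (Pr P [set w | Y k.+1 w = false] * c1 +
  Pr P [set w | Y k.+1 w = true] * Pr P [set w | Y k.+2 w = false] * c2) => E bE.
rewrite no_adjacent_ones_uptoS setIUr Pr_setU; last 3 first.
- rewrite setIA; apply: measurableI.
    exact: measurable_box (boxI false bE).
  exact: measurable_no_adjacent_ones_upto.
- rewrite !setIA; apply: measurableI.
    exact: measurable_box (boxI false (boxI true bE)).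
  exact: measurable_no_adjacent_ones_upto.
- by rewrite -subset0 => w /= [[_ [-> _]] [_ [[]]]].
rewrite !setIA h1; last exact: boxI.
rewrite h2; last by apply: boxI; exact: boxI.
rewrite (Pr_boxI _ (boxI true bE)) !Pr_boxI//; ring.
Qed.

Lemma Pr_box_no_adjacent_ones k E : box k E ->
  Pr P (E `&` no_adjacent_ones k.+1) = Pr P E * Pr P (no_adjacent_ones k.+1).
Proof.
move=> bE; have mE := measurable_box bE.
have fE n : Pr P (E `&` no_adjacent_ones_upto k.+1 n) =
    Pr P E * Pr P (setT `&` no_adjacent_ones_upto k.+1 n).
  have [c hc] := indep_upto n k; rewrite !hc//; last exact: boxT.
  by rewrite Pr_setT mul1r.
have := @no_adjacent_ones_upto_cvg k.+1 E mE; under eq_fun do rewrite fE.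
move=> /cvg_lim <-//; apply/cvg_lim => //; apply: cvgMr.
rewrite -[X in _ --> Pr P X]setTI.
exact: no_adjacent_ones_upto_cvg.
Qed.

Lemma no_adjacent_onesE i :
  no_adjacent_ones i =
  ([set w | Y i w = false] `&` no_adjacent_ones i.+1) `|`
  ([set w | Y i w = true] `&` [set w | Y i.+1 w = false] `&`
     no_adjacent_ones i.+2).
Proof.
apply/seteqP; split=> w /=.
  move=> h; have := h i (leqnn i); case Yi : (Y i w); case Yi1 : (Y i.+1 w) => // _.
  - by right; split=> // j jn; apply: h; lia.
  - by left; split=> // j jn; apply: h; lia.
  - by left; split=> // j jn; apply: h; lia.
move=> [[Yi h]|[[Yi Yi1] h]] j jn.
  have [->|ji] := eqVneq j i; first by rewrite Yi.
  by apply: h; lia.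
have [->|ji] := eqVneq j i; first by rewrite Yi1 andbF.
have [->|ji1] := eqVneq j i.+1; first by rewrite Yi1.
apply: h; lia.
Qed.

End no_adjacent_ones.

Lemma eq_eseries_nat (R : numFieldType) (N : nat) (f g : nat -> \bar R) :
  (forall i, (N <= i)%N -> f i = g i) ->
  (\sum_(N <= i <oo) f i = \sum_(N <= i <oo) g i)%E.
Proof.
move=> fg; apply/congr_lim/funext => n.
by apply: eq_big_nat => i /andP[Ni _]; exact: fg.
Qed.

(** * The numbers gamma and the positivity of the conditioning event *)

Section independent_sequence.
Context {d : measure_display} {T : measurableType d} {R : realType}.
Variable P : probability T R.
Variable Y : nat -> {RV P >-> bool}.
Hypothesis Yind : mutually_independent Y.

Lemma box_pred_eq i b : (0 < i)%N -> box Y i [set w | Y i w = b].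
Proof.
by case: i => // i _; rewrite -[X in box _ _ X]setTI; exact/boxI/boxT.
Qed.

(** The sum vanishes iff [Y i] is 0 and no adjacent ones occur from [i] on. When [Y i] is 0 the pair
    at [i] is harmless, so the second condition starts at [i.+1] and is independent of the first. *)
Lemma gamma_inftyE i : (0 < i)%N ->
  gamma_infty Y i =
  Pr P [set w | Y i w = false] * Pr P (no_adjacent_ones Y i.+1).
Proof.
move=> i0; rewrite -Pr_box_no_adjacent_ones//; last exact: box_pred_eq.
congr Pr; rewrite -(adjacent_ones_eq0 Y i.+1).
have -> : [set w | ((Y i w)%:R%:E + adjacent_ones Y i w = 0 :> \bar R)%E] =
    [set w | Y i w = false] `&` no_adjacent_ones Y i.
  rewrite -adjacent_ones_eq0; apply/seteqP; split=> w /=; last first.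
    by move=> [-> ->]; rewrite adde0.
  case: (Y i w) => /=; last by rewrite add0e.
  move=> h; have : (0 < 1 + adjacent_ones Y i w)%E.
    by apply: lt_le_trans lte01 _; rewrite leeDl// adjacent_ones_ge0.
  by rewrite h ltxx.
rewrite adjacent_ones_eq0; apply/seteqP; split=> w /= [Yi h]; split=> // j ij.
  by apply: h; lia.
have [->|ji] := eqVneq j i; first by rewrite Yi.
by apply: h; lia.
Qed.

Lemma Pr_no_adjacent_ones_rec i : (0 < i)%N ->
  Pr P (no_adjacent_ones Y i) =
  gamma_infty Y i + Pr P [set w | Y i w = true] * gamma_infty Y i.+1.
Proof.
case: i => // i _; rewrite !gamma_inftyE// no_adjacent_onesE Pr_setU; last 3 first.
- exact/measurableI/measurable_no_adjacent_ones/measurable_RV_eq.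
- apply/measurableI/measurable_no_adjacent_ones.
  exact/measurableI/measurable_RV_eq/measurable_RV_eq.
- by rewrite -subset0 => w /= [[-> _] [[]]].
rewrite !(Pr_box_no_adjacent_ones Yind); last 2 first.
- exact/boxI/box_pred_eq.
- exact: box_pred_eq.
by rewrite Pr_boxI ?mulrA//; exact: box_pred_eq.
Qed.

Hypothesis Yfalse_gt0 : forall i, (2 <= i)%N -> 0 < Pr P [set w | Y i w = false].
Hypothesis Ysummable : (\sum_(3 <= i <oo)
  (Pr P [set w | Y i w = true] * Pr P [set w | Y i.+1 w = true])%:E < +oo)%E.

(** Union bound far out, where the tail of the series is below 1, followed by a descent to [i]. The
    descent stops at 2 because [Y 1] may be almost surely 1. *)
Lemma Pr_no_adjacent_ones_gt0 i : (2 <= i)%N ->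
  0 < Pr P (no_adjacent_ones Y i).
Proof.
pose s i : \bar R := (Pr P [set w | Y i w = true] *
  Pr P [set w | Y i.+1 w = true])%:E.
have s0 k : (0 <= s k)%E by rewrite lee_fin mulr_ge0 ?Pr_ge0.
have sfin : (\sum_(0 <= i <oo) s i < +oo)%E.
  rewrite (nneseries_split 0 3)// add0n lte_add_pinfty//.
  by rewrite /s sumEFin ltry.
have [N N3 sN] : exists2 N, (3 <= N)%N & (\sum_(N <= i <oo) s i < 1)%E.
  have /fine_cvgP[fs cs] := nneseries_tail_cvg sfin (fun k _ => s0 k).
  have /cvgr_lt/(_ 1 ltr01) ls := cs.
  have : \forall N \near \oo, (3 <= N)%N /\ (\sum_(N <= i <oo) s i < 1)%E.
    near=> N; split; first by near: N; exact: nbhs_infty_ge.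
    rewrite -[ltLHS]fineK; last by near: N.
    by rewrite lte_fin; near: N.
  by move=> [N _ /(_ N (leqnn N))[]]; exists N.
have DN : 0 < Pr P (no_adjacent_ones Y N).
  have mN := measurable_no_adjacent_ones Y N.
  suff : (P (~` no_adjacent_ones Y N) < 1)%E.
    by rewrite probability_setC// -EFin_Pr// -EFinB lte_fin; lra.
  (* By independence each term of the tail is the probability of an adjacent pair of ones, and these
     pairs cover the complement. *)
  apply: le_lt_trans sN.
  have -> : (\sum_(N <= i <oo) s i = \sum_(N <= i <oo)
      P ([set w | Y i w = true] `&` [set w | Y i.+1 w = true]))%E.
    apply: eq_eseries_nat => j Nj.
    rewrite /s -(Pr_boxI Yind) ?EFin_Pr//; last by apply: box_pred_eq; lia.
    exact/measurableI/measurable_RV_eq/measurable_RV_eq.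
  apply: measure_sigma_subadditive_tail.
  - by move=> j; exact/measurableI/measurable_RV_eq/measurable_RV_eq.
  - exact: measurableC.
  - move=> w /= /existsNP[j /not_implyP[Nj /negP]]; rewrite negbK => /andP[Yj Yj1].
    by exists j => //=; apply/negP; rewrite -leqNgt.
move=> i2.
have [Ni|iN] := leqP N i.
  apply: (lt_le_trans DN); apply: le_Pr => [||w h j ij];
    [exact: measurable_no_adjacent_ones..|].
  by apply: h; lia.
(* Descending induction from [N]: the probability at index j is at least gamma at j, which is P(Y_j
   = 0) times the probability at j + 1. *)
have -> : i = (N - (N - i))%N by lia.
have : (2 <= N - (N - i))%N by lia.
elim: (N - i)%N => [|k IHk] k2; first by rewrite subn0.
rewrite Pr_no_adjacent_ones_rec; last by lia.
rewrite ltr_wpDr//.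
  by rewrite mulr_ge0 ?Pr_ge0.
rewrite gamma_inftyE; last by lia.
rewrite mulr_gt0// ?Yfalse_gt0//.
have -> : (N - k.+1).+1 = (N - k)%N by lia.
by apply: IHk; lia.
Unshelve. all: by end_near. Qed.

Lemma gamma_infty_gt0 i : (2 <= i)%N -> 0 < gamma_infty Y i.
Proof.
move=> i2; rewrite gamma_inftyE; last by lia.
by rewrite mulr_gt0 ?Yfalse_gt0// Pr_no_adjacent_ones_gt0//; lia.
Qed.

End independent_sequence.

(** * Laws on boolean sequences are determined by initial segments *)

Section laws_on_sequences.
Context {R : realType}.

Definition initial_segment (s : nat -> bool) (k : nat) : set (nat -> bool) :=
  [set x | forall j, (j < k)%N -> x j = s j].

Let S := g_sigma_algebraType cylinders.

Let measurable_coord i b : measurable ([set x | x i = b] : set S).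
Proof. by apply: sub_sigma_algebra; exists i, b. Qed.

Let measurable_initial_segment s k : measurable (initial_segment s k : set S).
Proof.
have -> : initial_segment s k = \bigcap_(j in `I_k) [set x | x j = s j] by [].
by apply: fin_bigcap_measurable; [exact: finite_II|move=> *; exact: measurable_coord].
Qed.

(** Initial segments are not closed under intersection, as two of them may be disjoint. The
    uniqueness theorem is therefore applied to the pi-system [G] of sets determined by finitely many
    coordinates, each of which is a finite disjoint union of initial segments. *)
Lemma eq_measure_initial_segments (m1 m2 : {measure set S -> \bar R}) :
  (m1 setT < +oo)%E ->
  (forall s k, m1 (initial_segment s k) = m2 (initial_segment s k)) ->
  forall A, <<s cylinders >> A -> m1 A = m2 A.
Proof.
move=> m1T m12 A mA.
pose determined k (B : set S) := forall x y : nat -> bool,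
  (forall j, (j < k)%N -> x j = y j) -> B x -> B y.
pose G := [set B : set S | measurable B /\ exists k, determined k B].
have Gcyl : measurable = <<s G >> :> set (set S).
  apply/seteqP; split.
    apply: sub_sigma_algebra2 => _ [i [b ->]]; split; first exact: measurable_coord.
    by exists i.+1 => x y xy /= <-; rewrite xy.
  apply: smallest_sub.
    exact: (smallest_sigma_algebra setT cylinders).
  by move=> B [].
apply: (@measure_unique _ R S G (fun=> setT)) => //.
- move=> B C [mB [k kB]] [mC [l lC]]; split; first exact: measurableI.
  exists (maxn k l) => x y xy [Bx Cx]; split.
    by apply: kB Bx => j jk; apply: xy; lia.
  by apply: lC Cx => j jk; apply: xy; lia.
- by move=> _; split=> //; exists 0%N.
- by rewrite bigcup_const //; exists 0%N.
move=> B [mB [k kB]].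
(* [n] counts the coordinates below [k] still free. With none left, [B] contains the segment or
   misses it; otherwise the segment is split according to coordinate [m]. *)
suff : forall n m s, k = (m + n)%N ->
    m1 (B `&` initial_segment s m) = m2 (B `&` initial_segment s m).
  move=> /(_ k 0%N (fun=> true) erefl).
  have -> : initial_segment (fun=> true) 0 = setT by apply/seteqP; split.
  by rewrite setIT.
elim=> [m s km|n IHn m s km].
  have [[x [Bx sx]]|h] := pselect (exists x, B x /\ initial_segment s m x).
    have -> : B `&` initial_segment s m = initial_segment s m; last exact: m12.
    apply/seteqP; split=> y /=; first by case.
    move=> sy; split=> //; apply: kB Bx => j jk.
    by rewrite sy ?sx//; lia.
  have -> : B `&` initial_segment s m = set0; last by rewrite !measure0.
  by rewrite -subset0 => x [Bx sx]; apply: h; exists x.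
pose t b j := if j == m then b else s j.
have tE b : initial_segment (t b) m.+1 =
    initial_segment s m `&` [set x | x m = b].
  apply/seteqP; split=> x /=.
    move=> h; split=> [j jm|]; last by rewrite h// /t eqxx.
    by rewrite h 1?ltnW// /t ifN//; lia.
  move=> [h xm] j jm; rewrite /t; case: eqVneq => [->//|jm'].
  by apply: h; lia.
have -> : B `&` initial_segment s m =
    (B `&` initial_segment (t true) m.+1) `|`
    (B `&` initial_segment (t false) m.+1).
  rewrite !tE; apply/seteqP; split=> x /=; last by tauto.
  by case: (x m) => -[]; tauto.
have mBt b : measurable (B `&` initial_segment (t b) m.+1) by exact: measurableI.
have disj : (B `&` initial_segment (t true) m.+1) `&`
    (B `&` initial_segment (t false) m.+1) = set0.
  by rewrite !tE -subset0 => x /= [[_ [_ ->]] [_ []]].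
rewrite !(measureU _ (mBt true) (mBt false) disj).
by congr (_ + _)%E; apply: IHn; lia.
Qed.

Lemma measurable_fun_path_of d (T : measurableType d) (P : probability T R)
    (X : nat -> {RV P >-> bool}) :
  measurable_fun setT (path_of X : T -> S).
Proof.
apply: (@measurability _ _ _ S _ _ cylinders) => //.
move=> _ [_ [i [b ->]] <-]; rewrite setTI.
exact: (measurable_RV_preimage (X i.+1) [set b]).
Qed.

Lemma measurable_path_of d (T : measurableType d) (P : probability T R)
    (X : nat -> {RV P >-> bool}) (A : set S) :
  measurable A -> measurable (path_of X @^-1` A).
Proof.
by move=> mA; rewrite -[X in measurable X]setTI; exact: measurable_fun_path_of.
Qed.

Lemma same_law_cond_law d1 (T1 : measurableType d1) (P1 : probability T1 R)
    (X : nat -> {RV P1 >-> bool}) d2 (T2 : measurableType d2)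
    (P2 : probability T2 R) (Y : nat -> {RV P2 >-> bool}) (E : set T2) :
  measurable E -> Pr P2 E != 0 ->
  (forall s k, law X (initial_segment s k) =
               cond_law Y E (initial_segment s k)) ->
  same_law (law X) (cond_law Y E).
Proof.
move=> mE PE0 XY.
have mX := measurable_fun_path_of X; have mY := measurable_fun_path_of Y.
have c_ge0 : 0 <= (Pr P2 E)^-1 by rewrite invr_ge0 Pr_ge0.
pose m1 : {measure set S -> \bar R} :=
  measure_function_pushforward__canonical__measure_function_Measure P1 mX.
(* The conditional law as a genuine measure: restrict to [E], push forward, divide by the mass of
   [E]. *)
pose m2 : {measure set S -> \bar R} :=
  mscale (NngNum c_ge0)
    (measure_function_pushforward__canonical__measure_function_Measure
       (mrestr P2 mE) mY).
have m1E A : measurable A -> m1 A = (law X A)%:E.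
  by move=> mA; rewrite /law EFin_Pr//; exact: measurable_path_of.
have m2E A : measurable A -> m2 A = (cond_law Y E A)%:E.
  move=> mA; rewrite /cond_law /cPr mulrC EFinM EFin_Pr//.
  by apply: measurableI => //; exact: measurable_path_of.
move=> A mA; apply: EFin_inj; rewrite -m1E// -m2E//.
apply: eq_measure_initial_segments => // [|s k].
  by rewrite m1E// ltry.
by rewrite m1E// m2E// XY.
Qed.

End laws_on_sequences.

(** * Contraction of the backward recursion *)

Section backward_recursion.
Context {R : realType}.

(** Subtracting the two recursions gives |u_i - v_i| = q_i |u_(i+1) - v_(i+1)|. Started at [n] from
    a difference of at most 1, the error at a fixed [i] is a product of q's, almost all below
    1/2. *)
Lemma backward_recursion_cvg (q v : nat -> R) (u : nat -> nat -> R) :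
  q n @[n --> \oo] --> 0 ->
  (forall i, (2 <= i)%N -> 0 <= q i <= 1) ->
  (forall i, (2 <= i)%N -> 0 <= v i <= 1) ->
  (forall n i, (2 <= n)%N -> 0 <= u n i <= 1) ->
  (forall i, (2 <= i)%N -> v i = q i * (1 - v i.+1)) ->
  (forall n i, (2 <= i < n)%N -> u n i = q i * (1 - u n i.+1)) ->
  forall i, (2 <= i)%N -> u n i @[n --> \oo] --> v i.
Proof.
move=> q0 q01 v01 u01 vrec urec i i2.
have [N _ qN] : \forall n \near \oo, q n < 2^-1.
  by move/cvgr_lt : q0; apply; rewrite invr_gt0.
(* The exponent counts the indices j with k <= j < k + m and N <= j, where q_j < 1/2; truncated
   subtraction makes it 0 if there are none. *)
have bound m k : (2 <= k)%N ->
    `|u (k + m)%N k - v k| <= 2^-1 ^+ (k + m - maxn N k).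
  elim: m k => [|m IHm] k k2.
    rewrite addn0; have -> : (k - maxn N k = 0)%N by lia.
    have := u01 k k k2; have := v01 k k2; rewrite expr0 ler_norml; lra.
  rewrite urec; last by lia.
  rewrite vrec// -mulrBr normrM; have /andP[qk0 qk1] := q01 k k2.
  have -> : 1 - u (k + m.+1)%N k.+1 - (1 - v k.+1) =
    - (u (k.+1 + m)%N k.+1 - v k.+1) by rewrite addSnnS; ring.
  rewrite normrN ger0_norm//; have {}IHm := IHm k.+1 ltac:(lia).
  have [Nk|kN] := boolP (N <= k)%N.
    have -> : (k + m.+1 - maxn N k = (k.+1 + m - maxn N k.+1).+1)%N by lia.
    by rewrite exprS ler_pM// ltW// qN.
  have -> : (k + m.+1 - maxn N k = (k.+1 + m - maxn N k.+1))%N by lia.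
  by rewrite -[leRHS]mul1r ler_pM.
apply/cvgrPdist_le => e e0.
have half0 : (2^-1 : R) ^+ n @[n --> \oo] --> 0.
  by apply: cvg_expr; rewrite ger0_norm ?invr_ge0// invf_lt1// ltr1n.
have /cvgr_lt/(_ _ e0)[K _ hK] := half0.
near=> n; rewrite distrC.
have ni : (i + maxn N i + K <= n)%N by near: n; exact: nbhs_infty_ge.
have := bound (n - i)%N i i2; have -> : (i + (n - i) = n)%N by lia.
by move=> /le_trans; apply; apply/ltW/hK => /=; lia.
Unshelve. all: by end_near. Qed.

End backward_recursion.

(** * One-step equations and path probabilities of the two chains *)

Section transitions.
Context {d : measure_display} {T : measurableType d} {R : realType}.
Variable P : probability T R.
Implicit Types U V : {RV P >-> bool}.

Lemma transition_negb U V a b k :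
  transition U V a b k -> transition U V a (~~ b) (1 - k).
Proof.
move=> h U0; have mU := measurable_RV_eq U a.
case: b h => /= /(_ U0) <-.
  by rewrite (cPr_RV_true V mU U0) opprB addrC subrK.
by rewrite (cPr_RV_true V mU U0).
Qed.

Lemma Pr_transition U V a b k : transition U V a b k ->
  Pr P ([set w | V w = b] `&` [set w | U w = a]) = k * Pr P [set w | U w = a].
Proof.
move=> h; rewrite Pr_setI_cPr; [|exact: measurable_RV_eq..].
have [->|/h ->//] := eqVneq (Pr P [set w | U w = a]) 0.
by rewrite !mulr0.
Qed.

End transitions.

(** A 1 at [r.+1] forces a 0 at [r], so only the transition from 0 contributes. *)
Lemma random_derangement_process_rec (R : realType) (p : nat -> R) n r
    d (T : measurableType d) (P : probability T R) (X : nat -> {RV P >-> bool}) :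
  random_derangement_process p n X -> (2 <= r < n)%N ->
  Pr P [set w | X r w = true] = q_ p r * (1 - Pr P [set w | X r.+1 w = true]).
Proof.
move=> [_ _ _ _ /(_ r)] h /andP[r2 rn].
have [_ h01 /transition_negb h11] := h ltac:(lia).
rewrite (Pr_RV_split (X r.+1) (measurable_RV_eq (X r) true)).
rewrite (Pr_transition h11) (Pr_transition h01) subrr mul0r add0r.
by rewrite Pr_RV_true subKr.
Qed.

Section chain.
Context {d : measure_display} {T : measurableType d} {R : realType}.
Variable P : probability T R.
Variables (f : nat -> R) (X : nat -> {RV P >-> bool}).
Hypothesis hX : limit_chain f X.

(** By induction P(X_i = 0) = 1 - f_i, which cancels the denominator of the jump probability. It
    shows later that conditioning on [X i = false] is legitimate. *)
Lemma limit_chain_marginal : f 2 = 0 -> (forall i, (2 <= i)%N -> f i < 1) ->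
  forall i, (2 <= i)%N -> Pr P [set w | X i w = true] = f i.
Proof.
move=> f2 f1; have [X1 _ tr] := hX.
have step i : (1 <= i)%N -> Pr P [set w | X i.+1 w = true] =
    f i.+1 / (1 - f i) * Pr P [set w | X i w = false].
  move=> i1; have [h01 h11] := tr i i1.
  rewrite (Pr_RV_split (X i) (measurable_RV_eq (X i.+1) true)).
  by rewrite (Pr_transition h11) (Pr_transition h01) mul0r add0r.
case=> [//|[//|i]] _; elim: i => [|i IHi].
  by rewrite step// f2 mul0r mul0r.
have := Pr_RV_true (X i.+2); rewrite IHi// => fE.
rewrite step//; have -> : Pr P [set w | X i.+2 w = false] = 1 - f i.+2 by lra.
by rewrite divfK// gt_eqF// subr_gt0 f1.
Qed.

Definition path_prefix (s : nat -> bool) (k : nat) : set T :=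
  [set w | forall j, (j <= k)%N -> X j.+1 w = s j].

Lemma path_prefixS s k :
  path_prefix s k.+1 = path_prefix s k `&` [set w | X k.+2 w = s k.+1].
Proof.
apply/seteqP; split=> w /=; first by move=> h; split=> [j jk|]; apply: h; lia.
move=> [h hk] j; rewrite leq_eqVlt => /orP[/eqP->//|jk]; exact: h.
Qed.

Lemma measurable_path_prefix s k : measurable (path_prefix s k).
Proof.
elim: k => [|k IHk]; last first.
  by rewrite path_prefixS; apply: measurableI => //; exact: measurable_RV_eq.
rewrite [X in measurable X](_ : _ = [set w | X 1 w = s 0%N]).
  exact: measurable_RV_eq.
by apply/seteqP; split=> w /= => [|h [|]//]; apply.
Qed.

End chain.

(* Transition matrix of a chain without adjacent ones which jumps from 0 to 1
   with probability h. *)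
Definition hard_core_step {R : realType} (h : R) (a b : bool) : R :=
  if a then (~~ b)%:R else if b then h else 1 - h.

Lemma limit_chain_prefixS d (T : measurableType d) (R : realType)
    (P : probability T R) (f : nat -> R) (X : nat -> {RV P >-> bool}) s k :
  limit_chain f X ->
  Pr P (path_prefix X s k.+1) = Pr P (path_prefix X s k) *
    hard_core_step (f k.+2 / (1 - f k.+1)) (s k) (s k.+1).
Proof.
move=> [_ /(_ k.+1)/(_ k s (ltnSn k)) /= mk /(_ k.+1 isT) [h01 h11]].
have mX := measurable_path_prefix X s k.
have mS := measurable_RV_eq (X k.+2) (s k.+1).
rewrite path_prefixS setIC Pr_setI_cPr// mulrC.
have [->|X0] := eqVneq (Pr P (path_prefix X s k)) 0; first by rewrite !mul0r.
congr (_ * _); rewrite mk//.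
have Xk0 : Pr P [set w | X k.+1 w = s k] != 0.
  rewrite gt_eqF// (@lt_le_trans _ _ (Pr P (path_prefix X s k)))//.
    by rewrite lt_neqAle eq_sym X0 Pr_ge0.
  by apply: le_Pr => // [|w]; [exact: measurable_RV_eq|apply].
have h00 := transition_negb h01; have h10 := transition_negb h11.
rewrite /hard_core_step.
case: (s k) (s k.+1) Xk0 => -[] Xk0.
- exact: h11.
- by rewrite h10// subr0.
- exact: h01.
- exact: h00.
Qed.

(** * Path probabilities of the conditioned Feller coupling *)

Section feller_prefix.
Context {d : measure_display} {T : measurableType d} {R : realType}.
Variable P : probability T R.
Variable Y : nat -> {RV P >-> bool}.
Hypothesis Yind : mutually_independent Y.

(** Once the path is prescribed, the window condition is either automatic or contradictory, so the
    event is a full prefix or empty. *)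
Lemma box_path_prefix s k :
  box Y k.+1 (path_prefix Y s k `&` no_adjacent_ones_upto Y 1 k).
Proof.
have [h|h] := pselect (forall j, (j < k)%N -> ~~ (s j && s j.+1)).
  exists (fun j => [set s j.-1]); apply/seteqP; split=> w /=.
    by move=> [sw _] [//|j] jk; exact: sw.
  move=> sw; have sw' j : (j <= k)%N -> Y j.+1 w = s j by move=> jk; apply: (sw j.+1).
  split=> // -[//|j] jk; rewrite !sw'; [|lia..].
  by apply: h; lia.
exists (fun=> set0); apply/seteqP; split=> w /=; last by move/(_ 1%N isT).
move=> [sw na]; case: h => j jk; have := na j.+1 ltac:(lia).
by rewrite !sw//; lia.
Qed.

(** Conditioned on having no adjacent ones, [Y] is a Markov chain: after a 1 the next value is
    forced, and after a 0 the future is independent of the past, so the jump probability is that of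
    Y_(k+2) = 1 given no adjacent ones from k + 2 on. *)
Lemma feller_prefixS s k : Pr P (no_adjacent_ones Y k.+2) != 0 ->
  Pr P (path_prefix Y s k.+1 `&` no_adjacent_ones Y 1) =
  Pr P (path_prefix Y s k `&` no_adjacent_ones Y 1) *
    hard_core_step (Pr P [set w | Y k.+2 w = true] * gamma_infty Y k.+3 /
      Pr P (no_adjacent_ones Y k.+2)) (s k) (s k.+1).
Proof.
move=> D0; rewrite path_prefixS /hard_core_step.
case sk : (s k).
  case: (s k.+1).
    rewrite mulr0 [X in Pr P X](_ : _ = set0) ?Pr_set0//.
    rewrite -subset0 => w /= [[sw Yk] na].
    by have := na k.+1 isT; rewrite sw// sk Yk.
  rewrite mulr1; congr Pr; apply/seteqP; split=> w /= [].
    by move=> [].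
  move=> sw na; split=> //; split=> //.
  by have := na k.+1 isT; rewrite sw// sk => /negbTE.
(* Since [s k] is 0, the pair at [k.+1] is harmless, and the event separates into a box up to [k.+1]
   and a condition from [k.+2] on. *)
have bE := box_path_prefix s k; set E := _ `&` _ in bE.
have naE : path_prefix Y s k `&` no_adjacent_ones Y 1 =
    E `&` no_adjacent_ones Y k.+2.
  apply/seteqP; split=> w /=.
    by move=> [sw na]; split=> [|j jk]; [split=> // j jk|]; apply: na; lia.
  move=> [[sw na1] na2]; split=> // j j1; have [jk|kj] := leqP j k.
    by apply: na1; lia.
  have [->|jk] := eqVneq j k.+1; first by rewrite sw// sk.
  by apply: na2; lia.
have -> : path_prefix Y s k `&` [set w | Y k.+2 w = s k.+1] `&`
    no_adjacent_ones Y 1 =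
    E `&` [set w | Y k.+2 w = s k.+1] `&` no_adjacent_ones Y k.+2.
  by rewrite setIAC naE setIAC.
rewrite naE (Pr_box_no_adjacent_ones Yind bE).
have [mE mD] := (measurable_box bE, measurable_no_adjacent_ones Y).
case: (s k.+1).
  rewrite [X in Pr P X](_ : _ = E `&` [set w | Y k.+2 w = true] `&`
      [set w | Y k.+3 w = false] `&` no_adjacent_ones Y k.+4).
    rewrite Pr_box_no_adjacent_ones//; last by do 2!apply: boxI.
    rewrite (Pr_boxI Yind _ (boxI true bE)) Pr_boxI// gamma_inftyE//; by field.
  rewrite [no_adjacent_ones Y k.+2]no_adjacent_onesE.
  by apply/seteqP; split=> w /=; case: (Y k.+2 w) => /=; intuition.
rewrite [X in Pr P X](_ : _ = E `&` [set w | Y k.+2 w = false] `&`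
    no_adjacent_ones Y k.+3).
  rewrite Pr_box_no_adjacent_ones//; last exact: boxI.
  rewrite Pr_boxI// -mulrA -gamma_inftyE//.
  rewrite -mulrA mulrBr mulr1 mulrCA divff// mulr1.
  by rewrite {1}Pr_no_adjacent_ones_rec// addrK.
rewrite [no_adjacent_ones Y k.+2]no_adjacent_onesE.
by apply/seteqP; split=> w /=; case: (Y k.+2 w) => /=; intuition.
Qed.

End feller_prefix.

(** * Algebra of the parameters and of the candidate for phi *)

Section parameters.
Context {R : realType}.
Variables (p theta : nat -> R).
Hypothesis p2 : p 2 = 1.
Hypothesis p01 : forall i, (3 <= i)%N -> 0 < p i < 1.
Hypothesis theta_def : forall n, (3 <= n)%N ->
  theta n = (n%:R - 1) * q_ p n / (p n * p n.-1).

Lemma p_bounds i : (2 <= i)%N -> 0 < p i <= 1.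
Proof.
rewrite leq_eqVlt => /orP[/eqP<-|/p01]; first by rewrite p2 ltr01 lexx.
by move=> /andP[-> /ltW].
Qed.

Lemma theta_ratio n : (3 <= n)%N ->
  theta n / (n%:R - 1 + theta n) = q_ p n / (q_ p n + p n * p n.-1).
Proof.
move=> n3; have /andP[pn0 pn1] := p01 n3.
have /andP[pn'0 _] := @p_bounds n.-1 ltac:(lia).
have n1 : 0 < n%:R - 1 :> R by rewrite subr_gt0 ltr1n; lia.
have s0 : 0 < q_ p n + p n * p n.-1 by rewrite addr_gt0 ?mulr_gt0 ?subr_gt0.
have -> : n%:R - 1 + theta n =
    (n%:R - 1) * (q_ p n + p n * p n.-1) / (p n * p n.-1).
  by rewrite theta_def//; field; rewrite !gt_eqF.
by rewrite theta_def//; field; rewrite !gt_eqF.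
Qed.

Lemma q_cvg0_iff :
  (q_ p n @[n --> \oo] --> (0 : R)) <-> (theta n / n%:R @[n --> \oo] --> (0 : R)).
Proof.
have thetaE n : (3 <= n)%N ->
    theta n / n%:R = (n%:R - 1) / n%:R * (q_ p n / (p n * p n.-1)).
  by move=> n3; rewrite theta_def//; ring.
split=> h.
(* Eventually [p n] and [p n.-1] are at least 1/2, whence the factor 4. *)
- have p_half : \forall n \near \oo, 2^-1 <= p n.
    move/cvgr_lt : h => /(_ 2^-1); rewrite invr_gt0 ltr0n => /(_ isT).
    by apply: filterS => n; rewrite /q_; lra.
  have [N _ pN] := p_half.
  apply: (@squeeze_cvgr _ _ _ _ (fun=> 0) (fun n => 4 * q_ p n)).
  + near=> n.
    have n3 : (N + 3 <= n)%N by near: n; exact: nbhs_infty_ge.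
    have pn : 2^-1 <= p n by apply: pN => /=; lia.
    have pn' : 2^-1 <= p n.-1 by apply: pN => /=; lia.
    have /andP[_ pn1] := @p01 n ltac:(lia).
    have q0 : 0 <= q_ p n by rewrite subr_ge0 ltW.
    have n0 : 0 < n%:R :> R by rewrite ltr0n; lia.
    have c0 : 0 <= (n%:R - 1) / n%:R :> R.
      by rewrite divr_ge0// subr_ge0 ler1n; lia.
    have c1 : (n%:R - 1) / n%:R <= 1 :> R by rewrite ler_pdivrMr//; lra.
    have pp : 4^-1 <= p n * p n.-1 by nra.
    have x0 : 0 <= q_ p n / (p n * p n.-1) by rewrite divr_ge0//; lra.
    have x4 : q_ p n / (p n * p n.-1) <= 4 * q_ p n.
      by rewrite ler_pdivrMr; nra.
    rewrite thetaE; last by lia.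
    by apply/andP; split; nra.
  + exact: cvg_cst.
  + by rewrite -[X in _ --> X](mulr0 4); exact: cvgMr.
(* The factor 2 comes from (n - 1)/n >= 1/2; dividing by [p n * p n.-1], which is at most 1, only
   enlarges the bound. *)
- apply: (@squeeze_cvgr _ _ _ _ (fun=> 0) (fun n => 2 * (theta n / n%:R))).
  + near=> n.
    have n3 : (3 <= n)%N by near: n; exact: nbhs_infty_ge.
    have /andP[pn0 pn1] := p01 n3.
    have /andP[pn'0 pn'1] := @p_bounds n.-1 ltac:(lia).
    have q0 : 0 <= q_ p n by rewrite subr_ge0 ltW.
    have n0 : 3 <= n%:R :> R by rewrite ler_nat.
    have c0 : 2^-1 <= (n%:R - 1) / n%:R :> R by rewrite ler_pdivlMr; lra.
    have pp0 : 0 < p n * p n.-1 by rewrite mulr_gt0.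
    have pp1 : p n * p n.-1 <= 1 by nra.
    have x1 : q_ p n <= q_ p n / (p n * p n.-1) by rewrite ler_pdivlMr//; nra.
    by rewrite thetaE// q0 /=; nra.
  + exact: cvg_cst.
  + by rewrite -[X in _ --> X](mulr0 2); exact: cvgMr.
Unshelve. all: by end_near. Qed.

(* phi_i is recovered from h_i := P(Y_i = 1 | no adjacent ones from i on) by
   solving phi_(i+1) / (1 - phi_i) = h_(i+1); g is gamma_(.,oo). *)
Definition phi_of (a g : nat -> R) (i : nat) : R :=
  q_ p i * g i.+1 / (g i.+1 + p i * a i.+1 * g i.+2).

Variables (a g : nat -> R).
Hypothesis a_ge0 : forall i, (2 <= i)%N -> 0 <= a i.
Hypothesis g_gt0 : forall i, (2 <= i)%N -> 0 < g i.
Hypothesis aE : forall i, (3 <= i)%N -> a i = q_ p i / (q_ p i + p i * p i.-1).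
Hypothesis g_rec : forall i, (2 <= i)%N ->
  g i = (1 - a i) * (g i.+1 + a i.+1 * g i.+2).

Let den_gt0 i : (2 <= i)%N -> 0 < g i.+1 + p i * a i.+1 * g i.+2.
Proof.
move=> i2; have /andP[p0 _] := p_bounds i2.
rewrite ltr_wpDr ?g_gt0//; last lia.
by rewrite !mulr_ge0 ?a_ge0 ?(ltW (g_gt0 _)) ?(ltW p0)//; lia.
Qed.

Lemma phi_of_bounds i : (2 <= i)%N -> 0 <= phi_of a g i < 1.
Proof.
move=> i2; have /andP[p0 p1] := p_bounds i2; have d0 := den_gt0 i2.
have g0 := @g_gt0 i.+1 ltac:(lia); have q0 : 0 <= q_ p i by rewrite subr_ge0.
rewrite divr_ge0 ?(ltW d0) ?mulr_ge0 ?(ltW g0)//= ltr_pdivrMr// mul1r.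
have : 0 <= p i * a i.+1 * g i.+2.
  by rewrite !mulr_ge0 ?a_ge0 ?(ltW (g_gt0 _)) ?(ltW p0)//; lia.
by rewrite /q_; nra.
Qed.

Lemma phi_of2 : phi_of a g 2 = 0.
Proof. by rewrite /phi_of /q_ p2 subrr !mul0r. Qed.

(** Expanding [g i.+1] by [g_rec] makes consecutive denominators of [phi_of] proportional. This
    reduces [phi_of_rec] and [phi_of_step] to identities over a common denominator. *)
Let den_rec i : (2 <= i)%N ->
  0 < q_ p i.+1 + p i.+1 * p i /\
  g i.+1 + p i * a i.+1 * g i.+2 = p i / (q_ p i.+1 + p i.+1 * p i) *
    (g i.+2 + p i.+1 * a i.+2 * g i.+3).
Proof.
move=> i2; have /andP[p0 p1] := p_bounds i2.
have /andP[p'0 p'1] := @p_bounds i.+1 ltac:(lia).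
have s0 : 0 < q_ p i.+1 + p i.+1 * p i.
  by rewrite ltr_wpDl ?mulr_gt0// subr_ge0.
have a1 := @aE i.+1 i2.
split=> //; rewrite g_rec ?a1//=; last by lia.
by rewrite /q_ in s0 *; field; rewrite gt_eqF.
Qed.

Lemma phi_of_rec i : (2 <= i)%N -> phi_of a g i = q_ p i * (1 - phi_of a g i.+1).
Proof.
move=> i2; have /andP[p0 _] := p_bounds i2.
have d0 := @den_gt0 i.+1 ltac:(lia); have [s0 denE] := den_rec i2.
have a1 := @aE i.+1 i2.
rewrite /phi_of denE g_rec ?a1//=; last by lia.
by rewrite /q_ in s0 d0 *; field; rewrite !gt_eqF.
Qed.

Lemma phi_of_step i : (2 <= i)%N ->
  phi_of a g i.+1 / (1 - phi_of a g i) =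
  a i.+1 * g i.+2 / (g i.+1 + a i.+1 * g i.+2).
Proof.
move=> i2; have /andP[p0 p1] := p_bounds i2; have d0 := den_gt0 i2.
have D0 : 0 < g i.+1 + a i.+1 * g i.+2.
  rewrite ltr_wpDr ?g_gt0//; last by lia.
  by rewrite mulr_ge0 ?a_ge0 ?(ltW (g_gt0 _))//; lia.
have -> : 1 - phi_of a g i =
    p i * (g i.+1 + a i.+1 * g i.+2) / (g i.+1 + p i * a i.+1 * g i.+2).
  by rewrite /phi_of /q_; field; rewrite gt_eqF.
have d'0 := @den_gt0 i.+1 ltac:(lia); have [s0 denE] := den_rec i2.
have -> : phi_of a g i.+1 =
    p i * a i.+1 * g i.+2 / (g i.+1 + p i * a i.+1 * g i.+2).
  rewrite denE /phi_of (@aE i.+1 i2)/=.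
  by rewrite /q_ in s0 *; field; rewrite !gt_eqF.
by field; rewrite !gt_eqF.
Qed.

End parameters.

Theorem theorem7 (R : realType) (p theta : nat -> R)
  (p1 : p 1%N = 0) (p2 : p 2%N = 1)
  (p01 : forall i, (3 <= i)%N -> 0 < p i < 1)
  (theta_gt0 : forall i, (1 <= i)%N -> 0 < theta i)
  (theta1 : theta 1%N = 1)
  (hi : forall n, (3 <= n)%N ->
     theta n = (n%:R - 1) * q_ p n / (p n * p n.-1)) :
  let S_q : \bar R := (\sum_(3 <= i <oo)
    (q_ p i * q_ p i.+1 /
     ((q_ p i + p i * p i.-1) * (q_ p i.+1 + p i.+1 * p i)))%:E)%E in
  let S_theta : \bar R := (\sum_(3 <= i <oo)
    (theta i * theta i.+1 /
     ((i%:R - 1 + theta i) * (i%:R + theta i.+1)))%:E)%E in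
  [/\ (q_ p n @[n --> \oo] --> (0 : R)) <->
      (theta n / n%:R @[n --> \oo] --> (0 : R)),
      S_q = S_theta &
      q_ p n @[n --> \oo] --> (0 : R) ->
      (S_q < +oo)%E ->
      forall
        (dn : nat -> measure_display) (Tn : forall n, measurableType (dn n))
        (Pn : forall n, probability (Tn n) R)
        (Xn : forall n, nat -> {RV (Pn n) >-> bool})
        (dX : measure_display) (TX : measurableType dX)
        (PX : probability TX R) (X : nat -> {RV PX >-> bool})
        (dY : measure_display) (TY : measurableType dY)
        (PY : probability TY R) (Y : nat -> {RV PY >-> bool}),
      (forall n, (2 <= n)%N -> random_derangement_process p n (Xn n)) ->
      limit_chain (phi Xn) X ->
      feller_coupling theta Y ->
      same_law (law X) (cond_law Y [set w | C1_infty Y w = 0%E]) /\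
      (forall i, (2 <= i)%N ->
        [/\ cPr PX [set w | X i.+1 w = true] [set w | X i w = false] =
              1 - cPr PX [set w | X i.+1 w = false] [set w | X i w = false],
            cPr PX [set w | X i.+1 w = true] [set w | X i w = false] =
              theta i.+1 * gamma_infty Y i.+2 /
              (theta i.+1 * gamma_infty Y i.+2 +
               (i%:R + theta i.+1) * gamma_infty Y i.+1) &
            (* X 2 = 1 is a null event, so for i = 2 there is nothing to
               condition on. *)
            Pr PX [set w | X i w = true] != 0 ->
            cPr PX [set w | X i.+1 w = true] [set w | X i w = true] =
              1 - cPr PX [set w | X i.+1 w = false] [set w | X i w = true] /\
            cPr PX [set w | X i.+1 w = true] [set w | X i w = true] = 0])].
Proof.
move=> S_q S_theta.
have pb := p_bounds p2 p01.
have ratio := theta_ratio p2 p01 hi.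
have Seq : S_q = S_theta.
  apply: eq_eseries_nat => i i3; congr EFin.
  have := ratio i.+1 (leqW i3); rewrite -{1}natr1 addrK /= => ratioS.
  by rewrite -mulf_div -[RHS]mulf_div ratio// ratioS.
split=> //; first exact: q_cvg0_iff.
move=> q0 Sfin dn Tn Pn Xn dX TX PX X dY TY PY Y hXn hX [Yind Yfalse].
pose a i := Pr PY [set w | Y i w = true].
pose g := gamma_infty Y.
pose D i := Pr PY (no_adjacent_ones Y i).
have aTheta i : (1 <= i)%N -> a i = theta i / (i%:R - 1 + theta i).
  move=> i1; rewrite /a Pr_RV_true Yfalse//; field.
  by rewrite gt_eqF// ltr_wpDl ?theta_gt0// subr_ge0 ler1n.
have Yfalse_gt0 i : (2 <= i)%N -> 0 < Pr PY [set w | Y i w = false].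
  move=> i2; have i1 : 0 < i%:R - 1 :> R by rewrite subr_gt0 ltr1n.
  by rewrite Yfalse 1?ltnW// divr_gt0// addr_gt0// theta_gt0 1?ltnW.
have aE i : (3 <= i)%N -> a i = q_ p i / (q_ p i + p i * p i.-1).
  by move=> i3; rewrite aTheta ?ratio//; lia.
have Ysummable : (\sum_(3 <= i <oo) (a i * a i.+1)%:E < +oo)%E.
  suff -> : (\sum_(3 <= i <oo) (a i * a i.+1)%:E = S_q)%E by [].
  apply: eq_eseries_nat => i i3; congr EFin.
  by rewrite -mulf_div !aE//; lia.
have D_gt0 i : (2 <= i)%N -> 0 < D i.
  exact: Pr_no_adjacent_ones_gt0.
have g_gt0 i : (2 <= i)%N -> 0 < g i by exact: gamma_infty_gt0.
have a_ge0 i : (2 <= i)%N -> 0 <= a i by rewrite Pr_ge0.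
have DE i : (2 <= i)%N -> D i = g i + a i * g i.+1.
  by move=> i2; apply: Pr_no_adjacent_ones_rec => //; lia.
have g_rec i : (2 <= i)%N -> g i = (1 - a i) * (g i.+1 + a i.+1 * g i.+2).
  move=> i2; rewrite /g gamma_inftyE//; last by lia.
  rewrite -/(D i.+1) DE; last by lia.
  by rewrite [a i]Pr_RV_true subKr.
pose v := phi_of p a g.
have v01 i : (2 <= i)%N -> 0 <= v i < 1 by exact: phi_of_bounds.
(* The marginals of the finite processes and [v] obey the same recursion, so the contraction
   identifies the limit. *)
have phiE i : (2 <= i)%N -> phi Xn i = v i.
  move=> i2; apply/cvg_lim => //.
  apply: (@backward_recursion_cvg _ (q_ p) v
    (fun n i => Pr (Pn n) [set w | Xn n i w = true])) => //.
  - by move=> j /pb /andP[pj0 pj1]; rewrite /q_; apply/andP; split; lra.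
  - by move=> j /v01 /andP[-> /ltW].
  - move=> n j _; rewrite Pr_ge0 -(Pr_setT (Pn n)) le_Pr//.
    exact: measurable_RV_eq.
  - by move=> j; exact: phi_of_rec.
  - move=> n j jn; have /hXn hn : (2 <= n)%N by lia.
    exact: random_derangement_process_rec hn jn.
have phi1 i : (2 <= i)%N -> phi Xn i < 1.
  by move=> i2; rewrite phiE//; case/andP: (v01 i i2).
have phi2 : phi Xn 2 = 0 by rewrite phiE// /v phi_of2.
have stepE i : (2 <= i)%N ->
    phi Xn i.+1 / (1 - phi Xn i) = a i.+1 * g i.+2 / D i.+1.
  move=> i2; rewrite !phiE//; last by lia.
  by rewrite DE ?phi_of_step//; lia.
have X_false i : (2 <= i)%N -> Pr PX [set w | X i w = false] != 0.
  move=> i2; have := Pr_RV_true (X i).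
  rewrite (limit_chain_marginal hX)// => XE.
  by have lt1 := phi1 i i2; rewrite gt_eqF//; lra.
have [X1 _ Xtr] := hX.
split.
  (* Positivity was obtained from index 2 on only; at 1 it follows because [Y 1] is almost surely
     1. *)
  have D1 : D 1%N = g 2.
    rewrite /D Pr_no_adjacent_ones_rec// gamma_inftyE// Yfalse// Pr_RV_true.
    by rewrite Yfalse// subrr !mul0r subr0 mul1r add0r.
  have D1_neq0 : D 1%N != 0 by rewrite D1 gt_eqF// g_gt0.
  have EE : [set w | C1_infty Y w = 0%E] = no_adjacent_ones Y 1.
    by rewrite -adjacent_ones_eq0.
  rewrite EE; apply: same_law_cond_law => //.
    exact: measurable_no_adjacent_ones.
  move=> s [|k].
    have iT : initial_segment s 0 = setT by apply/seteqP; split.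
    rewrite iT /law /cond_law /cPr !preimage_setT setTI Pr_setT.
    by rewrite divff.
  (* The preimage of an initial segment of length [k.+1] under [path_of] is [path_prefix] at [k], by
     conversion. *)
  suff : Pr PX (path_prefix X s k) =
    Pr PY (path_prefix Y s k `&` no_adjacent_ones Y 1) / D 1%N by [].
  have prefix0 dT (T : measurableType dT) (P : probability T R)
      (Z : nat -> {RV P >-> bool}) :
      path_prefix Z s 0 = [set w | Z 1%N w = s 0%N].
    by apply/seteqP; split=> w /= => [|h [|]//]; apply.
  have X1f : Pr PX [set w | X 1%N w = false] = 0.
    by have := Pr_RV_true (X 1%N); rewrite X1; lra.
  have Y1f : Pr PY [set w | Y 1%N w = false] = 0.
    by rewrite Yfalse// subrr mul0r.
  have Y1 : Pr PY ([set w | Y 1%N w = false] `&` no_adjacent_ones Y 1) = 0.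
    apply/eqP; rewrite eq_le Pr_ge0 andbT -Y1f le_Pr//.
    - exact/measurableI/measurable_no_adjacent_ones/measurable_RV_eq.
    - exact: measurable_RV_eq.
  elim: k => [|k IHk].
    rewrite !prefix0; case: (s 0%N); last by rewrite X1f Y1 mul0r.
    rewrite X1; have := Pr_RV_split (Y 1%N) (measurable_no_adjacent_ones Y 1).
    rewrite [_ `&` [set w | Y 1%N w = false]]setIC Y1 addr0 setIC => <-.
    by rewrite divff.
  rewrite (limit_chain_prefixS s k hX) (feller_prefixS Yind)//; last first.
    by rewrite gt_eqF// D_gt0.
  (* [stepE] starts at index 2. For the first step, a path starting with 1 has a forced
     continuation, whatever the jump probability, and one starting with 0 is null. *)
  rewrite IHk mulrAC; case: k IHk => [|k] IHk; last by rewrite stepE.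
  rewrite !prefix0; case: (s 0%N) => //.
  by rewrite Y1 !mul0r.
move=> i i2; have [h01 h11] := Xtr i ltac:(lia); split.
- by rewrite cPr_RV_true ?X_false//; exact: measurable_RV_eq.
(* Multiplying numerator and denominator by i + theta_(i+1) turns a_(i+1) into theta_(i+1). *)
- rewrite h01 ?X_false// stepE// DE; last by lia.
  have i0 : 0 < i%:R :> R by rewrite ltr0n; lia.
  have t0 := @theta_gt0 i.+1 isT.
  rewrite aTheta// -/g; have -> : i.+1%:R - 1 = i%:R :> R by rewrite -natr1 addrK.
  have g1 := @g_gt0 i.+1 ltac:(lia); have g2 := @g_gt0 i.+2 ltac:(lia).
  have e0 : 0 < theta i.+1 * g i.+2 + (i%:R + theta i.+1) * g i.+1.
    by rewrite addr_gt0// mulr_gt0// addr_gt0.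
  by field; rewrite !gt_eqF// ?addr_gt0.
- move=> X0; split; last exact: h11.
  by rewrite cPr_RV_true//; exact: measurable_RV_eq.
Qed.
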